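(* Let $W\ge 1$ be an integer, let $0\le b,m\le 1$ be constants such that $p^*_{fix}(i) := b - m\cdot\frac{i}{W}\in[0,1]$ for all $i\in\{1,\dots,W\}$, and let $\mathcal{O}^*_{fix}\subseteq\mathcal{O}_{overlap}=\{O^{(1)},\dots,O^{(W)}\}$ be a random subset with $\Pr(O^{(i)}\in\mathcal{O}^*_{fix})=p^*_{fix}(i)$ for every $i\in\{1,\dots,W\}$. Write $\mathbb{E}[n^*_{fix}]=\mathbb{E}[|\mathcal{O}^*_{fix}|]=\sum_{i=1}^W p^*_{fix}(i)=\left(b-\frac m2\right)W-\frac m2$. Let $\sigma_R,\sigma_F\in[0,1]$ with $\sigma_F W$ an integer. Then the expected false negative (FN) and false positive (FP) errors of the methods Random $\sigma_R$, First $\sigma_F$, and L-RHO (with FP rate $\alpha$ and FN rate $\beta$), as defined in the context, are: 1. Random: $\mathbb{E}[n^{\text{Random}}_{fn}]=(1-\sigma_R)\,\mathbb{E}[n^*_{fix}]$ and $\mathbb{E}[n^{\text{Random}}_{fp}]=\sigma_R\,(W-\mathbb{E}[n^*_{fix}])$; 2. First: $\mathbb{E}[n^{\text{First}}_{fn}]=(1-\sigma_F)\left(\mathbb{E}[n^*_{fix}]-\frac m2\sigma_F W\right)$ and $\mathbb{E}[n^{\text{First}}_{fp}]=\sigma_F\left(W-\mathbb{E}[n^*_{fix}]-\frac m2(1-\sigma_F)W\right)$; 3. L-RHO: $\mathbb{E}[n^{\text{L-RHO}}_{fn}]=\beta\,\mathbb{E}[n^*_{fix}]$ and $\mathbb{E}[n^{\text{L-RHO}}_{fp}]=\alpha\,(W-\mathbb{E}[n^*_{fix}])$.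 Furthermore, suppose the additive term $-\frac m2$ in $\mathbb{E}[n^*_{fix}]$ is ignored, i.e. $\mathbb{E}[n^*_{fix}]$ is replaced by $\left(b-\frac m2\right)W$ both in the closed-form expressions $\mathbb{E}[n^{\text{Random}}_{fn}]=(1-\sigma_R)\,\mathbb{E}[n^*_{fix}]$, $\mathbb{E}[n^{\text{Random}}_{fp}]=\sigma_R\,(W-\mathbb{E}[n^*_{fix}])$ for Random and $\mathbb{E}[n^{\text{First}}_{fn}]=(1-\sigma_F)\left(\mathbb{E}[n^*_{fix}]-\frac m2\sigma_F W\right)$, $\mathbb{E}[n^{\text{First}}_{fp}]=\sigma_F\left(W-\mathbb{E}[n^*_{fix}]-\frac m2(1-\sigma_F)W\right)$ for First, and in the denominators $W-\mathbb{E}[n^*_{fix}]$ and $\mathbb{E}[n^*_{fix}]$ defining the FP and FN rates respectively, where $b-\frac m2\neq 0$ and $1-b+\frac m2\neq 0$. Then the FP and FN rates of First $\sigma_F$ are $$(\alpha_F,\beta_F)=\left(\frac{\sigma_F\left(1-b+\frac m2\sigma_F\right)}{1-b+\frac m2},\; 1-\frac{\sigma_F\left(b-\frac m2\sigma_F\right)}{b-\frac m2}\right),$$ and the FP and FN rates of Random $\sigma_R$ are $(\alpha_R,\beta_R)=(\sigma_R,\,1-\sigma_R)$.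
   Context: The setting is one iteration of rolling horizon optimization. There is a set $\mathcal{O}_{overlap}=\{O^{(1)},\dots,O^{(W)}\}$ of $W$ (overlapping) operations, indexed in a fixed order (the rolling horizon sequence order). The oracle set $\mathcal{O}^*_{fix}\subseteq\mathcal{O}_{overlap}$ is a random subset. A method outputs a (possibly random) subset $\mathcal{O}_{fix}\subseteq\mathcal{O}_{overlap}$. Errors. For a given method, set $\mathcal{O}_{fn}=\mathcal{O}^*_{fix}\setminus\mathcal{O}_{fix}$ and $\mathcal{O}_{fp}=\mathcal{O}_{fix}\setminus\mathcal{O}^*_{fix}$. The (expected) FN error and FP error are $\mathbb{E}[n_{fn}]=\mathbb{E}[|\mathcal{O}_{fn}|]$ and $\mathbb{E}[n_{fp}]=\mathbb{E}[|\mathcal{O}_{fp}|]$. Rates. The (expected) FP rate of a method is $\mathbb{E}[n_{fp}]/(W-\mathbb{E}[n^*_{fix}])$ and its (expected) FN rate is $\mathbb{E}[n_{fn}]/\mathbb{E}[n^*_{fix}]$ (when the denominators are nonzero). Methods. - Random $\sigma_R$: $\mathcal{O}_{fix}$ is obtained by including each operation of $\mathcal{O}_{overlap}$ with probability $\sigma_R$, i.i.d. across operations and independently of $\mathcal{O}^*_{fix}$. - First $\sigma_F$: $\mathcal{O}_{fix}=\{O^{(1)},\dots,O^{(\sigma_F W)}\}$, the first $\sigma_F$ fraction of the operations in the given order. - L-RHO: $\mathcal{O}_{fix}$ is the output of a learned predictor, an arbitrary random subset of $\mathcal{O}_{overlap}$ whose (expected) FP and FN rates, in the sense above, are denoted $\alpha$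 and $\beta$ respectively. *)

(* Defs.v *)
From HB Require Import structures.
From mathcomp Require Import all_boot all_order all_algebra.
From mathcomp Require Import all_classical all_reals all_analysis.

Set Implicit Arguments.
Unset Strict Implicit.
Unset Printing Implicit Defensive.

Import Order.TTheory GRing.Theory Num.Theory.
Import numFieldNormedType.Exports.

Local Open Scope classical_set_scope.
Local Open Scope ring_scope.

(* The operations O^(1), ..., O^(W) are indexed from zero: the ordinal
   i : 'I_W stands for O^(i.+1). *)

Section RandomSubsets.
Context (d : measure_display) (T : measurableType d) (R : realType).
Variable P : probability T R.

(* Measurability for the discrete sigma-algebra on a finite type. *)
Definition discrete_rv (D : finType) (X : T -> D) : Prop :=
  forall A : set D, measurable (X @^-1` A).

Definition indep_rv (D1 D2 : finType) (X : T -> D1) (Y : T -> D2) : Prop :=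
  forall (A : set D1) (B : set D2),
    P (X @^-1` A `&` Y @^-1` B) = (P (X @^-1` A) * P (Y @^-1` B))%E.

Definition mutually_indep_rv (I D : finType) (X : I -> T -> D) : Prop :=
  forall (J : {set I}) (A : I -> set D),
    P (\bigcap_(i in [set` J]) X i @^-1` A i) =
    (\prod_(i in J) P (X i @^-1` A i))%E.

Variable W : nat.

(* The cardinality is bounded by W, so for a [discrete_rv] the expectation is
   finite and [fine] loses nothing. *)
Definition mean_card (X : T -> {set 'I_W}) : R :=
  fine ('E_P[fun t => #|X t|%:R])%E.

Section Errors.
Variables Ostar Ofix : T -> {set 'I_W}.

Definition fn_error : R := mean_card (fun t => (Ostar t :\: Ofix t)%SET).
Definition fp_error : R := mean_card (fun t => (Ofix t :\: Ostar t)%SET).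

(* The rates associated with error values [efp], [efn] when [N] is the value
   used for the expected size of the oracle set. *)
Definition fp_ratio (N efp : R) : R := efp / (W%:R - N).
Definition fn_ratio (N efn : R) : R := efn / N.

Definition fp_rate : R := fp_ratio (mean_card Ostar) fp_error.
Definition fn_rate : R := fn_ratio (mean_card Ostar) fn_error.

(* [alpha] and [beta] are the FP and FN rates; a rate is unconstrained when its
   denominator vanishes, where the ratio is undefined. *)
Definition has_rates (alpha beta : R) : Prop :=
  (W%:R - mean_card Ostar != 0 -> alpha = fp_rate) /\
  (mean_card Ostar != 0 -> beta = fn_rate).

Definition random_method (s : R) : Prop :=
  [/\ discrete_rv Ofix,
      forall i : 'I_W, P [set t | i \in Ofix t] = s%:E,
      mutually_indep_rv (fun (i : 'I_W) t => i \in Ofix t) &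
      indep_rv Ofix Ostar].

End Errors.
End RandomSubsets.

Section ClosedForms.
Variable R : realType.

Definition first_method (T : Type) (W : nat) (s : R) : T -> {set 'I_W} :=
  fun _ => [set i : 'I_W | (i.+1)%:R <= s * W%:R]%SET.

Definition p_fix (b m : R) (W i : nat) : R := b - m * (i%:R / W%:R).

(* [N] is the expected size of the oracle set, kept as an argument so that its
   approximation can be substituted for it. *)
Definition random_fn (s N : R) : R := (1 - s) * N.
Definition random_fp (W : nat) (s N : R) : R := s * (W%:R - N).
Definition first_fn (W : nat) (m s N : R) : R :=
  (1 - s) * (N - m / 2 * s * W%:R).
Definition first_fp (W : nat) (m s N : R) : R :=
  s * (W%:R - N - m / 2 * (1 - s) * W%:R).

End ClosedForms.

Arguments first_method {R} T W s.

(* Main.v *)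
Require Import Defs.
From HB Require Import structures.
From mathcomp Require Import all_boot all_order all_algebra.
From mathcomp Require Import all_classical all_reals all_analysis.
From mathcomp Require Import ring lra.
Import Order.TTheory GRing.Theory Num.Theory.
Import numFieldNormedType.Exports.
Local Open Scope classical_set_scope.
Local Open Scope ring_scope.

(* The expected size of a random subset of 'I_W is the sum of its inclusion
   probabilities, so each error reduces to a sum over operations. If a rate has
   a vanishing denominator, the corresponding error vanishes as well, since the
   false negatives lie in the oracle set and the false positives in its
   complement. *)

Section MeanCard.
Set Implicit Arguments.
Unset Strict Implicit.
Context (d : measure_display) (T : measurableType d) (R : realType).
Variables (P : probability T R) (W : nat).
Implicit Types X Y : T -> {set 'I_W}.

Lemma discrete_rv_mem X i : discrete_rv X -> measurable [set t | i \in X t].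
Proof. by move=> /(_ [set B : {set 'I_W} | i \in B]). Qed.

(** There are only finitely many pairs of values, so the preimage splits into a finite union of
    intersections of fibres of [X] and [Y]. *)
Lemma discrete_rv_setD X Y :
  discrete_rv X -> discrete_rv Y -> discrete_rv (fun t => X t :\: Y t)%SET.
Proof.
move=> mX mY A.
have -> : (fun t => X t :\: Y t)%SET @^-1` A =
    \bigcup_(p in [set p : {set 'I_W} * {set 'I_W} | A (p.1 :\: p.2)%SET])
      (X @^-1` [set p.1] `&` Y @^-1` [set p.2]).
  apply/seteqP; split=> [t At|t [[B C]]] /=; first by exists (X t, Y t).
  by move=> ABC [-> ->].
apply: fin_bigcup_measurable; first exact: finite_finset.
by move=> p _; exact: measurableI.
Qed.

Lemma discrete_rv_cst (B : {set 'I_W}) : discrete_rv (fun _ : T => B).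
Proof.
move=> A; rewrite preimage_cst.
by case: ifP => _; [exact: measurableT | exact: measurable0].
Qed.

(** Linearity of expectation: the cardinality is a sum of indicators, whose integrals are the
    marginal probabilities. The dependence between distinct operations does not enter. *)
Lemma mean_card_sum X : discrete_rv X ->
  mean_card P X = \sum_(i < W) fine (P [set t | i \in X t]).
Proof.
move=> mX; rewrite /mean_card unlock.
have cardE t : (#|X t|%:R : R) = \sum_(i < W) \1_[set t | i \in X t] t.
  rewrite -sum1_card natr_sum big_mkcond /=.
  apply: eq_bigr => i _; rewrite indicE.
  have -> : (t \in [set t | i \in X t]) = (i \in X t) by exact: asboolb.
  by case: ifP.
under eq_integral do rewrite cardE -sumEFin.
rewrite ge0_integral_sum //; last first.
  move=> i; apply/measurable_realfun.measurable_EFinP.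
  by apply: measurable_realfun.measurable_indic; exact: discrete_rv_mem.
have intE i : (\int[P]_x (\1_[set t | i \in X t] x)%:E = P [set t | i \in X t])%E.
  by rewrite integral_indic ?setIT //; exact: discrete_rv_mem.
rewrite -sum_fine => [|i _]; first by apply: eq_bigr => i _; rewrite intE.
by rewrite intE fin_num_measure //; exact: discrete_rv_mem.
Qed.

Lemma mean_card_ge0 X : discrete_rv X -> 0 <= mean_card P X.
Proof.
by move=> mX; rewrite mean_card_sum // sumr_ge0 // => i _; rewrite fine_ge0.
Qed.

(** Monotonicity of each inclusion probability suffices. This bounds the L-RHO errors when the
    denominator of a rate vanishes. *)
Lemma mean_card_subset X Y : discrete_rv X -> discrete_rv Y ->
  (forall t, X t \subset Y t) -> mean_card P X <= mean_card P Y.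
Proof.
move=> mX mY XY; rewrite !mean_card_sum //; apply: ler_sum => i _.
have mXi := discrete_rv_mem i mX; have mYi := discrete_rv_mem i mY.
rewrite fine_le ?fin_num_measure // le_measure ?inE // => t /=.
exact: (fintype.subsetP (XY t)).
Qed.

Lemma discrete_rv_setC X : discrete_rv X -> discrete_rv (fun t => ~: X t)%SET.
Proof. by move=> mX A; exact: (mX [set B | A (~: B)%SET]). Qed.

Lemma mean_card_setC X : discrete_rv X ->
  mean_card P (fun t => ~: X t)%SET = W%:R - mean_card P X.
Proof.
move=> mX; rewrite !mean_card_sum //; last first.
  exact: discrete_rv_setC.
rewrite -[in W%:R](card_ord W) -sum1_card natr_sum -sumrB.
apply: eq_bigr => i _; have mXi := discrete_rv_mem i mX.
have -> : [set t | i \in (~: X t)%SET] = ~` [set t | i \in X t].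
  by apply/seteqP; split=> t /=; rewrite inE => /negP.
by rewrite probability_setC // fineB // fin_num_measure.
Qed.

(** For each [i], independence is applied to the family of subsets containing [i] and to its
    complement. Exchanging [X] and [Y] turns one error of Random into the other. *)
Lemma mean_card_setD_indep X Y : discrete_rv X -> discrete_rv Y ->
  indep_rv P X Y ->
  mean_card P (fun t => X t :\: Y t)%SET =
  \sum_(i < W) fine (P [set t | i \in X t]) * (1 - fine (P [set t | i \in Y t])).
Proof.
move=> mX mY indep; rewrite mean_card_sum; last exact: discrete_rv_setD.
apply: eq_bigr => i _.
have mXi := discrete_rv_mem i mX; have mYi := discrete_rv_mem i mY.
have -> : [set t | i \in (X t :\: Y t)%SET] =
    X @^-1` [set B : {set 'I_W} | i \in B] `&`
    Y @^-1` (~` [set B : {set 'I_W} | i \in B]).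
  apply/seteqP; split=> t /=; rewrite inE.
    by case/andP=> /negP.
  by case=> -> /negP ->.
rewrite indep preimage_setC probability_setC //.
by rewrite fineM ?fineB ?fin_numB ?fin_num_measure.
Qed.

End MeanCard.

Lemma indep_rv_sym (d : measure_display) (T : measurableType d)
    (R : realType) (P : probability T R) (D1 D2 : finType)
    (X : T -> D1) (Y : T -> D2) :
  indep_rv P X Y -> indep_rv P Y X.
Proof. by move=> XY A B; rewrite setIC XY muleC. Qed.

(** The number of terms is kept separate from the scale [W]: [n = W] gives the expected oracle size,
    and smaller [n] the prefix fixed by First. *)
Lemma sum_p_fix (R : realType) (b m : R) (W n : nat) : (0 < W)%N ->
  \sum_(i < n) p_fix b m W i.+1 =
  n%:R * b - m / 2 * n%:R * (n%:R + 1) / W%:R.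
Proof.
move=> W0; have W_neq0 : W%:R != 0 :> R by rewrite pnatr_eq0 -lt0n.
elim: n => [|n IH]; first by rewrite big_ord0; field.
by rewrite big_ord_recr /= IH /p_fix -natr1; field.
Qed.

Lemma sum_ord_if (R : realType) (W k : nat) (F : nat -> R) : (k <= W)%N ->
  \sum_(i < W) (if (i < k)%N then F i else 0) = \sum_(i < k) F i.
Proof. by move=> kW; rewrite (big_ord_widen _ F kW) [RHS]big_mkcond. Qed.

Theorem proposition1 (d : measure_display) (T : measurableType d)
    (R : realType) (P : probability T R)
    (W : nat) (b m : R) (Ostar : T -> {set 'I_W}) (sR sF : R)
    (W_ge1 : (1 <= W)%N)
    (b01 : 0 <= b <= 1) (m01 : 0 <= m <= 1)
    (p01 : forall i : nat, (1 <= i <= W)%N -> 0 <= p_fix b m W i <= 1)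
    (Ostar_rv : discrete_rv Ostar)
    (Ostar_p : forall i : 'I_W,
        P [set t | i \in Ostar t] = (p_fix b m W i.+1)%:E)
    (sR01 : 0 <= sR <= 1) (sF01 : 0 <= sF <= 1)
    (sFW_int : sF * W%:R \is a Num.int) :
  let N := mean_card P Ostar in
  let N' := (b - m / 2) * W%:R in
  (* size of the oracle set *)
  (N = \sum_(1 <= i < W.+1) p_fix b m W i /\ N = N' - m / 2) /\
  (* Random *)
  (forall OR : T -> {set 'I_W}, random_method P Ostar OR sR ->
     fn_error P Ostar OR = random_fn sR N /\
     fp_error P Ostar OR = random_fp W sR N) /\
  (* First *)
  (fn_error P Ostar (first_method T W sF) = first_fn W m sF N /\
   fp_error P Ostar (first_method T W sF) = first_fp W m sF N) /\
  (* L-RHO *)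
  (forall (OL : T -> {set 'I_W}) (alpha beta : R),
     discrete_rv OL -> has_rates P Ostar OL alpha beta ->
     fn_error P Ostar OL = beta * N /\
     fp_error P Ostar OL = alpha * (W%:R - N)) /\
  (* rates when N is replaced by N' *)
  (b - m / 2 != 0 -> 1 - b + m / 2 != 0 ->
   (fp_ratio W N' (first_fp W m sF N'), fn_ratio N' (first_fn W m sF N')) =
     (sF * (1 - b + m / 2 * sF) / (1 - b + m / 2),
      1 - sF * (b - m / 2 * sF) / (b - m / 2)) /\
   (fp_ratio W N' (random_fp W sR N'), fn_ratio N' (random_fn sR N')) =
     (sR, 1 - sR)).
Proof.
move=> N N'.
have W_neq0 : W%:R != 0 :> R by rewrite pnatr_eq0 -lt0n.
have mO i := discrete_rv_mem i Ostar_rv.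
have NE : N = \sum_(i < W) p_fix b m W i.+1.
  by rewrite /N mean_card_sum //; apply: eq_bigr => i _; rewrite Ostar_p.
have NN' : N = N' - m / 2 by rewrite NE sum_p_fix // /N'; field.
split; first by split; rewrite // NE big_add1 big_mkord.
split.
  move=> OR [mOR OR_p _ indep].
  rewrite /fn_error /fp_error /random_fn /random_fp mean_card_setD_indep //; last first.
    exact: indep_rv_sym.
  (* Writing [W] as a sum of ones turns [W - N] into a sum of [1 - p_fix], so both identities can be
     checked term by term. *)
  rewrite mean_card_setD_indep // -[in W%:R](card_ord W) -sum1_card natr_sum.
  rewrite NE -sumrB !mulr_sumr; split; apply: eq_bigr => i _;
    by rewrite OR_p Ostar_p //= mulrC.
split.
  (* [k] is the number of operations that First fixes. *)
  have [k sWE] : exists k : nat, sF * W%:R = k%:R.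
    apply/natrP; rewrite natrEint sFW_int mulr_ge0 ?ler0n //.
    by case/andP: sF01.
  have kW : (k <= W)%N.
    by rewrite -(ler_nat R) -sWE ler_piMl ?ler0n //; case/andP: sF01.
  have sE : sF = k%:R / W%:R by rewrite -sWE mulfK.
  (* The ordinal [i] stands for operation [i.+1], so the condition [i.+1 <= k] reads [i < k]. *)
  have firstE t i : (i \in first_method T W sF t) = (i < k)%N.
    by rewrite inE sWE ler_nat.
  have mF : discrete_rv (first_method T W sF) by exact: discrete_rv_cst.
  rewrite /fn_error /fp_error !mean_card_sum //; last 2 first.
    1,2: exact: discrete_rv_setD.
  (* A full term minus a term cut off at [k]: the sum becomes the total over [W] minus the prefix
     over [k], both covered by [sum_p_fix]. *)
  have fnE (i : 'I_W) :
      fine (P [set t | i \in (Ostar t :\: first_method T W sF t)%SET]) =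
      p_fix b m W i.+1 - (if (i < k)%N then p_fix b m W i.+1 else 0).
    case: ifPn => ik.
      have -> : [set t | i \in (Ostar t :\: first_method T W sF t)%SET] = set0.
        by apply/seteqP; split=> t //=; rewrite inE firstE ik.
      by rewrite measure0 subrr.
    rewrite subr0; have -> : [set t | i \in (Ostar t :\: first_method T W sF t)%SET] =
        [set t | i \in Ostar t].
      by apply/seteqP; split=> t /=; rewrite inE firstE ik.
    by rewrite Ostar_p.
  have fpE (i : 'I_W) :
      fine (P [set t | i \in (first_method T W sF t :\: Ostar t)%SET]) =
      (if (i < k)%N then 1 - p_fix b m W i.+1 else 0).
    case: ifPn => ik.
      have -> : [set t | i \in (first_method T W sF t :\: Ostar t)%SET] =
          ~` [set t | i \in Ostar t].
        by apply/seteqP; split=> t /=; rewrite inE firstE ik andbT => /negP.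
      by rewrite probability_setC // Ostar_p.
    have -> : [set t | i \in (first_method T W sF t :\: Ostar t)%SET] = set0.
      by apply/seteqP; split=> t //=; rewrite inE firstE (negbTE ik) andbF.
    by rewrite measure0.
  rewrite (eq_bigr _ (fun i _ => fnE i)) (eq_bigr _ (fun i _ => fpE i)).
  rewrite NE /first_fn /first_fp sE; split.
    rewrite sumrB (sum_ord_if (fun i => p_fix b m W i.+1)) // !sum_p_fix //.
    by field.
  rewrite (sum_ord_if (fun i => 1 - p_fix b m W i.+1)) // sumrB.
  by rewrite sumr_const card_ord !sum_p_fix //; field.
split.
  move=> OL alpha beta mOL [alphaE betaE]; split.
    (* If [N = 0], [has_rates] leaves [beta] free, but the FN error lies between 0 and [N], so both
       sides are 0. *)
    have [N0|N0] := eqVneq N 0; last by rewrite betaE // /fn_rate /fn_ratio divfK.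
    rewrite N0 mulr0; apply: le_anti; rewrite mean_card_ge0 ?andbT; last first.
      exact: discrete_rv_setD.
    rewrite -[leRHS]N0; apply: mean_card_subset => //.
      exact: discrete_rv_setD.
    by move=> t; exact: subsetDl.
  (* Likewise, the FP error is at most the mean size of the complement of the oracle set, which is
     [W - N]. *)
  have [N0|N0] := eqVneq (W%:R - N) 0.
    rewrite N0 mulr0; apply: le_anti; rewrite mean_card_ge0 ?andbT; last first.
      exact: discrete_rv_setD.
    rewrite -[leRHS]N0 -mean_card_setC //; apply: mean_card_subset.
    - exact: discrete_rv_setD.
    - exact: discrete_rv_setC.
    - by move=> t; rewrite finset.setDE finset.subsetIr.
  by rewrite alphaE // /fp_rate /fp_ratio divfK.
move=> bm0 bm1.
(* These are the two nonvanishing hypotheses with the halves cleared, the form in which [field] asks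
   for them. *)
have bm0' : b * 2 - m != 0.
  by apply: contraNneq bm0 => e; apply/eqP; lra.
have bm1' : (1 - b) * 2 + m != 0.
  by apply: contraNneq bm1 => e; apply/eqP; lra.
have N'0 : N' != 0 by rewrite mulf_neq0.
have WN'E : W%:R - N' = (1 - b + m / 2) * W%:R by rewrite /N'; ring.
have WN'0 : W%:R - N' != 0 by rewrite WN'E mulf_neq0.
split.
  rewrite /fp_ratio /fn_ratio /first_fp /first_fn WN'E /N'.
  by congr pair; field; rewrite ?bm0' ?bm1' W_neq0.
by rewrite /fp_ratio /fn_ratio /random_fp /random_fn !mulfK.
Qed.
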